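(* Let $R$ be a commutative Noetherian local ring and let $0\to M^{\oplus a}\to K\to(\Omega^n_RM)^{\oplus b}\to0$ be a short exact sequence of finitely generated $R$-modules, where $a,b\ge1$ and $n\ge0$ are integers, such that $\operatorname{cx}_R(K)=c$ for some integer $c\ge0$. Then: (i) if $a<b$, then $\operatorname{cx}_R(M)=\operatorname{cx}_R(K)$; (ii) if $a=b$, then $\operatorname{cx}_R(M)\le\operatorname{cx}_R(K)+1$; (iii) if $a>b$, then either $\operatorname{cx}_R(M)=\operatorname{cx}_R(K)$ or $\operatorname{cx}_R(M)=\infty$.
   Context: $\Omega^n_RM$ is the $n$-th syzygy in a minimal free resolution ($\Omega^0_RM=M$), and $\beta_i(M)$ is the $i$-th Betti number of $M$. The complexity $\operatorname{cx}_R(M)$ is the smallest integer $r\ge0$ such that there is a real number $A$ with $\beta_i(M)\le A\, i^{r-1}$ for all $i\gg0$; it is $\infty$ if no such $r$ exists. *)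

(* Defs.v *)
From HB Require Import structures.
From mathcomp Require Import all_boot all_order all_algebra.
From Stdlib Require Reals ClassicalEpsilon.
Set Implicit Arguments. Unset Strict Implicit. Unset Printing Implicit Defensive.
Import GRing.Theory.
Local Open Scope ring_scope.

Section CommAlg.
Variable Rg : comUnitRingType.

Definition is_ideal (I : Rg -> Prop) : Prop :=
  I 0 /\ (forall x y, I x -> I y -> I (x + y)) /\ (forall r x, I x -> I (r * x)).

Definition is_maximal_ideal (m : Rg -> Prop) : Prop :=
  is_ideal m /\ ~ m 1 /\
  forall I, is_ideal I -> ~ I 1 -> (forall x, m x -> I x) -> forall x, I x -> m x.

Definition is_local_ring : Prop :=
  exists m, is_maximal_ideal m /\
    forall m', is_maximal_ideal m' -> forall x, m' x <-> m x.

Definition is_noetherian_ring : Prop :=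
  forall I, is_ideal I -> exists s : seq Rg,
    forall x, I x <-> exists c : 'I_(size s) -> Rg, x = \sum_(i < size s) c i * s`_i.

Definition fin_gen (M : lmodType Rg) : Prop :=
  exists n (f : {linear 'rV[Rg]_n -> M}), forall x, exists v, f v = x.

(* A minimal free resolution of M:
     ... -> F_{i+1} --d i--> F_i -> ... -> F_0 --eps--> M -> 0,
   F_i = 'rV_(b i) (row vectors, maps act by right multiplication),
   exact, and minimal: all entries of every d i lie in the maximal ideal. *)
Definition minres (M : lmodType Rg) (b : nat -> nat)
  (d : forall i, 'M[Rg]_(b i.+1, b i)) (eps : {linear 'rV[Rg]_(b 0) -> M}) : Prop :=
  (forall x, exists v, eps v = x) /\
  (forall v, eps v = 0 <-> exists w, v = w *m d 0) /\
  (forall i (v : 'rV[Rg]_(b i.+1)), v *m d i = 0 <-> exists w, v = w *m d i.+1) /\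
  (forall m, is_maximal_ideal m -> forall i j k, m (d i j k)).

Definition has_minres (M : lmodType Rg) (b : nat -> nat) : Prop :=
  exists d eps, @minres M b d eps.

(* Betti numbers beta_i(M): ranks of a (chosen) minimal free resolution
   (independent of the choice); 0 if none exists (never happens for f.g.
   modules over a Noetherian local ring). *)
Definition betti (M : lmodType Rg) : nat -> nat :=
  match ClassicalEpsilon.excluded_middle_informative (exists b, has_minres M b) with
  | left h => proj1_sig (ClassicalEpsilon.constructive_indefinite_description _ h)
  | right _ => fun _ => 0%N
  end.

Definition is_syzygy (n : nat) (M N : lmodType Rg) : Prop :=
  match n with
  | 0%N => exists f : {linear N -> M}, bijective f
  | m.+1 => exists b d eps, @minres M b d eps /\
      exists iota : {linear N -> 'rV[Rg]_(b m)}, injective iota /\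
        forall v, (exists x, iota x = v) <-> exists w, v = w *m d m
  end.

End CommAlg.

Definition cx_bound (beta : nat -> nat) (r : nat) : Prop :=
  exists (A : Reals.Rdefinitions.R) (N : nat), forall i, (N <= i)%N ->
    Reals.Rdefinitions.Rle (Reals.Raxioms.INR (beta i))
      (Reals.Rdefinitions.Rmult A
         (Reals.Rfunctions.powerRZ (Reals.Raxioms.INR i) (BinInt.Z.sub (BinInt.Z.of_nat r) (BinNums.Zpos BinNums.xH)))).

Definition cx_is (Rg : comUnitRingType) (M : lmodType Rg) (c : option nat) : Prop :=
  match c with
  | Some r => cx_bound (betti M) r /\ forall s, cx_bound (betti M) s -> (r <= s)%N
  | None => forall r, ~ cx_bound (betti M) r
  end.

(* Main.v *)
(* The comparison map P -> Q between minimal free resolutions of M^a and K has a mapping cone that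
   resolves (Omega^n M)^b.  Modulo the maximal ideal the cone differential is the comparison map
   alone, and comparing the cone with the minimal resolution of (Omega^n M)^b yields, with
   beta = betti M and kappa = betti K,
     b beta(i+1+n) <= kappa(i+1) + a beta(i),   a beta(i) <= b beta(i+1+n) + kappa(i),
     kappa(i) <= b beta(i+n) + a beta(i).
   The third inequality gives cx K <= cx M.  The first bounds beta by a geometric recursion when
   a < b and by a summation when a = b.  When b < a the second says that beta is controlled by
   kappa unless it grows exponentially. *)
From Stdlib Require Import Reals Lra.
Require Import Defs.
From HB Require Import structures.
From mathcomp Require Import all_boot all_order all_algebra zify.
From mathcomp Require boolp classical_sets.
Set Implicit Arguments. Unset Strict Implicit. Unset Printing Implicit Defensive.
Import GRing.Theory.
Local Open Scope ring_scope.

Delimit Scope R_scope with coqR.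
Delimit Scope Z_scope with coqZ.

(** * Local rings, their residue ring, and rank comparison by determinants *)

(** A non-unit generates a proper ideal, which Zorn's lemma enlarges to a maximal one; by locality
    that ideal is [m]. *)
Lemma local_unit (R : comUnitRingType) (m : R -> Prop) (x : R) :
  is_local_ring R -> is_maximal_ideal m -> ~ m x -> x \is a GRing.unit.
Proof.
move=> [m0 [_ uniq_m0]] max_m nmx; apply/negP => /negP nUx; apply: nmx.
pose T := {I : R -> Prop | is_ideal I /\ ~ I 1 /\ I x}.
pose leT (I J : T) := boolp.asbool (forall y, sval I y -> sval J y).
have ideal_x : is_ideal (fun y => exists r, y = r * x).
  split; first by exists 0; rewrite mul0r.
  split=> [_ _ [r ->] [s ->]|r _ [s ->]]; first by exists (r + s); rewrite mulrDl.
  by exists (r * s); rewrite mulrA.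
have proper_x : ~ exists r, 1 = r * x.
  by move=> [r rx1]; case/negP: nUx; apply/unitrP; exists r; rewrite [x * r]mulrC -rx1.
have x_x : exists r, x = r * x by exists 1; rewrite mul1r.
pose Ix0 : T := exist _ (fun y => exists r, y = r * x) (conj ideal_x (conj proper_x x_x)).
have [|I J L /boolp.asboolP IJ /boolp.asboolP JL|A totA|] :=
    @classical_sets.ZL_preorder T Ix0 leT.
- by move=> I; apply/boolp.asboolP.
- by apply/boolp.asboolP => y /IJ; exact: JL.
(* The union of an empty chain would not contain [x], so the principal ideal serves as its upper
   bound. *)
- have [[I0 AI0]|A0] := boolp.EM (exists I, A I); last first.
    exists Ix0 => I AI.
    by case: A0; exists I.
  pose U y := exists2 I, A I & sval I y.
  have idealU : is_ideal U.
    split; first by exists I0 => //; case: (svalP I0) => -[].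
    split=> [y z [I AI Iy] [J AJ Jz]|r y [I AI Iy]]; last first.
      by exists I => //; case: (svalP I) => -[_ [_]] IM _; exact: IM.
    case: (totA I J AI AJ) => /boolp.asboolP sub; [exists J => //|exists I => //].
      by case: (svalP J) => -[_ [JD _]] _; apply: JD => //; exact: sub.
    by case: (svalP I) => -[_ [ID _]] _; apply: ID => //; exact: sub.
  have properU : ~ U 1 by move=> [I _ I1]; case: (svalP I) => _ [].
  have Ux : U x by exists I0 => //; case: (svalP I0) => _ [].
  exists (exist _ U (conj idealU (conj properU Ux)) : T) => I AI.
  by apply/boolp.asboolP => y Iy; exists I.
move=> [I [idI [properI Ix]]] maxI.
have max_I : is_maximal_ideal I.
  split=> //; split=> // J idJ properJ IJ y Jy.
  have Jx := IJ _ Ix.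
  have /boolp.asboolP := maxI (exist _ J (conj idJ (conj properJ Jx)) : T)
    (introT (boolp.asboolP _) IJ).
  exact.
by apply/(uniq_m0 _ max_m)/(uniq_m0 _ max_I).
Qed.

Lemma residue_ring (R : comUnitRingType) (m : R -> Prop) :
  is_ideal m -> ~ m 1 ->
  exists (k : comNzRingType) (p : {rmorphism R -> k}), forall x, m x -> p x = 0.
Proof.
move=> [m0 [mD mM]] m1.
pose I : {pred R} := fun x => boolp.asbool (m x).
have inI x : x \in I <-> m x by split=> /boolp.asboolP.
have idI : idealr_closed I.
  split; [exact/inI|by apply/negP=> /inI|].
  by move=> a x y /inI mx /inI my; apply/inI/mD => //; exact: mM.
pose S : idealr R := HB.pack I (isIdealr.Build R I idI).
exists {ideal_quot S}; exists (\pi_({ideal_quot S})%qT : {rmorphism R -> {ideal_quot S}}).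
move=> x mx; apply/eqP.
rewrite -(rmorph0 (\pi_({ideal_quot S})%qT : {rmorphism R -> {ideal_quot S}})).
by rewrite -Quotient.idealrBE subr0; apply/inI.
Qed.

(** If [m < n], padding [A] with zero columns and [B] with zero rows gives square matrices with
    product 1, although the padded [A] has determinant 0. *)
Lemma mulmx1_leq (k : comNzRingType) (n m : nat) (A : 'M[k]_(n, m)) (B : 'M_(m, n)) :
  A *m B = 1%:M -> (n <= m)%N.
Proof.
move=> AB1; rewrite leqNgt; apply/negP => lt_mn.
(* The padding width is written as a successor so that [ord0] names one of the zero columns. *)
have nE : (m + (n - m.+1).+1 = n)%N by rewrite -subSn // subSS subnKC // ltnW.
move: A B AB1; case: _ / nE => A B AB1.
have /eqP : \det (row_mx A 0 *m col_mx B (0 : 'M[k]_((n - m.+1).+1, _))) = 1.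
  by rewrite mul_row_col mul0mx addr0 AB1 det1.
rewrite det_mulmx (expand_det_col _ (rshift m ord0)) big1 ?mul0r 1?eq_sym ?oner_eq0 //.
by move=> i _; rewrite row_mxEr mxE mul0r.
Qed.

(** * Lifting, comparison of free resolutions, and invariance of Betti numbers *)

Lemma dependent_choice (T : nat -> Type) (S : forall i, T i -> T i.+1 -> Prop) (x0 : T 0%N) :
  (forall i x, exists y, S i x y) ->
  exists f : forall i, T i, f 0%N = x0 /\ forall i, S i (f i) (f i.+1).
Proof.
move=> ex; exists (nat_rect T x0 (fun i x => sval (boolp.cid (ex i x)))).
by split=> // i; exact: (svalP (boolp.cid (ex i _))).
Qed.

Lemma rows_factor (R : comUnitRingType) (p k n : nat) (X : 'M[R]_(p, n)) (D : 'M_(k, n)) :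
  (forall i, exists w, row i X = w *m D) -> exists Y, X = Y *m D.
Proof.
move=> /boolp.choice[w wE]; exists (\matrix_i w i).
by apply/row_matrixP => i; rewrite row_mul rowK.
Qed.

(** Preimages of the basis vectors are chosen and extended linearly. Asking only that [pr] reach the
    image of [h] allows [pr] to be an inclusion, and the lift is then a corestriction. *)
Lemma free_lift (R : comUnitRingType) (n : nat) (L F : lmodType R)
    (h : {linear 'rV[R]_n -> L}) (pr : {linear F -> L}) :
  (forall v, exists x, pr x = h v) ->
  exists e : {linear 'rV[R]_n -> F}, forall v, pr (e v) = h v.
Proof.
move=> surj; have [x xE] := boolp.choice (fun j => surj (delta_mx 0 j)).
pose e (v : 'rV[R]_n) := \sum_j v 0 j *: x j.
have lin_e : linear e.
  move=> c u v; rewrite /e scaler_sumr -big_split; apply: eq_bigr => j _ /=.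
  by rewrite !mxE scalerDl scalerA.
pose e' : {linear 'rV[R]_n -> F} := HB.pack e (GRing.isLinear.Build _ _ _ _ e lin_e).
exists e' => v; rewrite [in RHS](row_sum_delta v) !linear_sum; apply: eq_bigr => j _.
by rewrite !linearZ xE.
Qed.

Definition aug_complex (R : comUnitRingType) (M : lmodType R) (b : nat -> nat)
    (d : forall i, 'M[R]_(b i.+1, b i)) (eps : {linear 'rV[R]_(b 0) -> M}) : Prop :=
  (forall w, eps (w *m d 0%N) = 0) /\ forall i, d i.+1 *m d i = 0.

(** [minres] without minimality: a mapping cone of minimal resolutions is exact but need not be
    minimal. *)
Definition free_res (R : comUnitRingType) (M : lmodType R) (b : nat -> nat)
    (d : forall i, 'M[R]_(b i.+1, b i)) (eps : {linear 'rV[R]_(b 0) -> M}) : Prop :=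
  (forall x, exists v, eps v = x) /\
  (forall v, eps v = 0 <-> exists w, v = w *m d 0%N) /\
  (forall i (v : 'rV[R]_(b i.+1)), v *m d i = 0 <-> exists w, v = w *m d i.+1).

Section Comparison.
Variable R : comUnitRingType.

Lemma minres_free_res (M : lmodType R) b d eps : @minres R M b d eps -> free_res d eps.
Proof. by case=> ? [? [? _]]. Qed.

Lemma free_res_complex (M : lmodType R) b d (eps : {linear 'rV[R]_(b 0) -> M}) :
  free_res d eps -> aug_complex d eps.
Proof.
move=> [_ [ker0 ker]]; split=> [w|i]; first by apply/ker0; exists w.
by apply/row_matrixP => j; rewrite row_mul row0; apply/ker; exists (delta_mx 0 j); rewrite rowE.
Qed.

Lemma res_factor (M : lmodType R) b d (eps : {linear 'rV[R]_(b 0) -> M}) i p (X : 'M_(p, b i.+1)) :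
  free_res d eps -> X *m d i = 0 -> exists Y, X = Y *m d i.+1.
Proof.
move=> [_ [_ ker]] Xd0; apply: rows_factor => j; apply/ker.
by rewrite -row_mul Xd0 row0.
Qed.

Lemma res_factor0 (M : lmodType R) b d (eps : {linear 'rV[R]_(b 0) -> M}) p (X : 'M[R]_(p, b 0%N)) :
  free_res d eps -> (forall v, eps (v *m X) = 0) -> exists Y : 'M_(p, b 1%N), X = Y *m d 0%N.
Proof.
by move=> [_ [ker _]] Xe0; apply: rows_factor => j; apply/ker; rewrite rowE.
Qed.

Section TwoComplexes.
Context (A B : lmodType R) (g b : nat -> nat).
Context (D : forall i, 'M[R]_(g i.+1, g i)) (epsA : {linear 'rV[R]_(g 0) -> A}).
Context (d : forall i, 'M[R]_(b i.+1, b i)) (epsB : {linear 'rV[R]_(b 0) -> B}).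
Hypotheses (cplxA : aug_complex D epsA) (resB : free_res d epsB).

Lemma chain_lift (h : {linear A -> B}) :
  exists u : forall i, 'M_(g i, b i), (forall v, epsB (v *m u 0%N) = h (epsA v)) /\
    forall i, D i *m u i = u i.+1 *m d i.
Proof.
have [e eE] := @free_lift _ _ _ _ (h \o epsA) epsB (fun v => resB.1 (h (epsA v))).
(* The invariant carried along is exactly the solvability of the equation for the next component. *)
pose ok i (u : 'M_(g i, b i)) := exists u', D i *m u = u' *m d i.
have ok0 : ok 0%N (lin1_mx e).
  by apply: (res_factor0 resB) => v; rewrite mulmxA mul_rV_lin1 eE /= cplxA.1 linear0.
have step i (s : {u | ok i u}) : exists s' : {u | ok i.+1 u}, D i *m sval s = sval s' *m d i.
  case: s => u [u' uE]; have oku' : ok i.+1 u'.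
    by apply: (res_factor resB); rewrite -mulmxA -uE mulmxA cplxA.2 mul0mx.
  by exists (exist _ u' oku').
have [f [f0 fS]] := dependent_choice (exist _ _ ok0) step.
by exists (fun i => sval (f i)); split=> // v; rewrite f0 mul_rV_lin1 eE.
Qed.

Lemma chain_homotopy (u : forall i, 'M_(g i, b i)) :
  (forall v, epsB (v *m u 0%N) = 0) -> (forall i, D i *m u i = u i.+1 *m d i) ->
  exists s : forall i, 'M_(g i, b i.+1), u 0%N = s 0%N *m d 0%N /\
    forall i, u i.+1 = D i *m s i + s i.+1 *m d i.+1.
Proof.
move=> u0 uS; have [s0 s0E] := res_factor0 resB u0.
(* By the chain map relation, [ok] says that [u i.+1 - D i *m s] is a cycle for [d i], hence factors
   through [d i.+1]. *)
pose ok i (s : 'M_(g i, b i.+1)) := D i *m (u i - s *m d i) = 0.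
have ok0 : ok 0%N s0 by rewrite /ok -s0E subrr mulmx0.
have step i (s : {s | ok i s}) :
    exists s' : {s | ok i.+1 s}, u i.+1 = D i *m sval s + sval s' *m d i.+1.
  case: s => s oks /=; have [|s' s'E] := @res_factor _ _ _ _ i _ (u i.+1 - D i *m s) resB.
    by rewrite mulmxBl -uS -mulmxA -mulmxBr.
  have oks' : ok i.+1 s'.
    by rewrite /ok -s'E opprB addrC subrK mulmxA cplxA.2 mul0mx.
  by exists (exist _ s' oks'); rewrite /= -s'E addrC subrK.
have [f [f0 fS]] := dependent_choice (exist _ _ ok0) step.
by exists (fun i => sval (f i)); split=> //; rewrite f0.
Qed.

End TwoComplexes.

(* Two resolutions of the same module are homotopy equivalent, so the identity of one is, up to
   terms involving its differential, a map through the other. *)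
Lemma free_res_size (M : lmodType R) (k : comNzRingType) (p : {rmorphism R -> k}) g b D d
    (epsG : {linear 'rV[R]_(g 0) -> M}) (eps : {linear 'rV[R]_(b 0) -> M}) (r : nat -> nat) :
  free_res D epsG -> free_res d eps ->
  (forall i, exists (X : 'M_(_, r i)) Y, map_mx p (D i) = X *m Y) ->
  (g 0 <= b 0 + r 0)%N /\ forall i, (g i.+1 <= b i.+1 + r i + r i.+1)%N.
Proof.
move=> resG res fact.
have [u [u0 uS]] := chain_lift (free_res_complex resG) res idfun.
have [v [v0 vS]] := chain_lift (free_res_complex res) resG idfun.
(* This chain map lifts the zero map, so it is null-homotopic. *)
pose w i := 1%:M - u i *m v i.
have w0 x : epsG (x *m w 0%N) = 0.
  by rewrite mulmxBr mulmx1 mulmxA linearB v0 u0 subrr.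
have wS i : D i *m w i = w i.+1 *m D i.
  by rewrite mulmxBr mulmxBl mulmx1 mul1mx mulmxA uS -mulmxA vS mulmxA.
have [s [s0 sS]] := chain_homotopy (free_res_complex resG) resG w0 wS.
have one i : 1%:M = u i *m v i + w i by rewrite addrC subrK.
split=> [|i].
  have [X [Y DE]] := fact 0%N.
  apply: (@mulmx1_leq k _ _ (row_mx (map_mx p (u 0%N)) (map_mx p (s 0%N) *m X))
    (col_mx (map_mx p (v 0%N)) Y)).
  by rewrite mul_row_col -mulmxA -DE -!map_mxM -map_mxD -s0 -one map_mx1.
have [X [Y DE]] := fact i; have [X' [Y' DE']] := fact i.+1.
(* The identity equals [u v + D s + s D]; over [k] the two differentials pass through ranks [r i]
   and [r i.+1], whence the three blocks. *)
apply: (@mulmx1_leq k _ _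
  (row_mx (row_mx (map_mx p (u i.+1)) X) (map_mx p (s i.+1) *m X'))
  (col_mx (col_mx (map_mx p (v i.+1)) (Y *m map_mx p (s i))) Y')).
rewrite !mul_row_col mulmxA -DE -mulmxA -DE' -!map_mxM -!map_mxD -addrA -sS.
by rewrite -one map_mx1.
Qed.

(** The differentials of a minimal resolution vanish in the residue ring, so they factor through
    rank 0 and the size comparison applies in both directions. *)
Lemma betti_minres (M : lmodType R) b i :
  is_local_ring R -> has_minres M b -> betti M i = b i.
Proof.
move=> [m [max_m _]] hb; have [k [p p0]] := residue_ring max_m.1 max_m.2.1.
have le b1 b2 : has_minres M b1 -> has_minres M b2 -> (b1 i <= b2 i)%N.
  move=> [d1 [e1 min1]] [d2 [e2 /minres_free_res res2]].
  have fact j : exists (X : 'M_(b1 j.+1, 0)) (Y : 'M_(0, b1 j)), map_mx p (d1 j) = X *m Y.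
    exists 0, 0; rewrite mul0mx; apply/matrixP => x y; rewrite !mxE p0 //.
    exact: min1.2.2.2.
  have := free_res_size (r := fun=> 0%N) (minres_free_res min1) res2 fact.
  by case: i => [|j] [le0 leS]; [move: le0|move: (leS j)]; rewrite !addn0.
rewrite /betti; case: ClassicalEpsilon.excluded_middle_informative => [h|[]]; last by exists b.
case: ClassicalEpsilon.constructive_indefinite_description => b' hb' /=.
by apply/anti_leq/andP; split; apply: le.
Qed.

End Comparison.

(** * Mapping cones, finite direct sums and syzygies *)

Section Cone.
Variable R : comUnitRingType.

Definition cone_rank (p q : nat -> nat) (i : nat) : nat :=
  if i is j.+1 then (p j + q j.+1)%N else q 0%N.

Section ConeDiff.
Context (p q : nat -> nat) (dp : forall i, 'M[R]_(p i.+1, p i)).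
Context (dq : forall i, 'M[R]_(q i.+1, q i)) (phi : forall i, 'M[R]_(p i, q i)).

(** The mapping cone of [phi], acting on row vectors; the sign on [dp] makes consecutive
    differentials compose to zero. *)
Definition cone_diff (i : nat) : 'M[R]_(cone_rank p q i.+1, cone_rank p q i) :=
  match i with
  | 0 => col_mx (phi 0%N) (dq 0%N)
  | j.+1 => block_mx (- dp j) (phi j.+1) 0 (dq j.+1)
  end.

(** The first component of a cone cycle is a boundary in the resolution of [A]; correcting by [phi]
    turns the second one into a cycle, hence a boundary, in the resolution of [B]. *)
Lemma cone_free_res (A B C : lmodType R) (f : {linear A -> B}) (g : {linear B -> C}) epsp epsq :
  injective f -> (forall y, exists x, g x = y) -> (forall x, g x = 0 <-> exists y, f y = x) ->
  @free_res R A p dp epsp -> @free_res R B q dq epsq ->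
  (forall v, epsq (v *m phi 0%N) = f (epsp v)) ->
  (forall i, dp i *m phi i = phi i.+1 *m dq i) ->
  free_res cone_diff (g \o epsq).
Proof.
move=> inj_f surj_g exact_fg resp resq phi0 phiS.
have [surjp [kerp0 kerp]] := resp; have [surjq [kerq0 kerq]] := resq.
split=> [y|].
  by have [x <-] := surj_g y; have [v <-] := surjq x; exists v.
split=> [v /=|[|i] v /=].
- split=> [/exact_fg [y yE]|[w ->]].
    have [x xE] := surjp y.
    have /kerq0 [w wE] : epsq (v - x *m phi 0%N) = 0 by rewrite linearB phi0 xE yE subrr.
    by exists (row_mx x w); rewrite mul_row_col -wE addrC subrK.
  rewrite -[w]hsubmxK mul_row_col linearD phi0 linearD.
  have /exact_fg -> : exists y, f y = f (epsp (lsubmx w)) by exists (epsp (lsubmx w)).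
  have /kerq0 -> : exists y, rsubmx w *m dq 0%N = y *m dq 0%N by exists (rsubmx w).
  by rewrite linear0 addr0.
- rewrite -[v]hsubmxK; move: (lsubmx v) (rsubmx v) => {v} x y; rewrite mul_row_col.
  split=> [/eqP xy0|[w]]; last first.
    rewrite -[w]hsubmxK; move: (lsubmx w) (rsubmx w) => {}w z.
    rewrite mul_row_block mulmx0 addr0 => /eq_row_mx[-> ->].
    rewrite mulmxDl mulmxN mulNmx -!mulmxA -phiS (free_res_complex resq).2 mulmx0 addr0.
    by rewrite addNr.
  have xphi : x *m phi 0%N = - y *m dq 0%N by apply/eqP; rewrite mulNmx -addr_eq0.
  (* At the bottom of the cone, injectivity of [f] supplies the cycle condition on [x]. *)
  have /kerp0 [w wE] : epsp x = 0.
    apply: inj_f; rewrite linear0 -phi0; apply/kerq0; exists (- y); exact: xphi.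
  have /kerq [z zE] : (y + w *m phi 1%N) *m dq 0%N = 0.
    by rewrite mulmxDl -mulmxA -phiS mulmxA -wE xphi mulNmx subrr.
  exists (row_mx (- w) z); rewrite mul_row_block mulmx0 addr0 mulNmx mulmxN opprK -wE.
  by rewrite mulNmx -zE addrC addrK.
- rewrite -[v]hsubmxK; move: (lsubmx v) (rsubmx v) => {v} x y; rewrite mul_row_block.
  rewrite mulmx0 addr0; split=> [|[w]]; last first.
    rewrite -[w]hsubmxK; move: (lsubmx w) (rsubmx w) => {}w z.
    rewrite mul_row_block mulmx0 addr0 => /eq_row_mx[-> ->].
    rewrite !mulmxN !mulNmx opprK -mulmxA (free_res_complex resp).2 mulmx0.
    rewrite mulmxDl -!mulmxA -phiS (free_res_complex resq).2 mulmx0 addr0.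
    by rewrite addNr row_mx0.
  rewrite -(row_mx0 _ 1 (p i) (q i.+1)) => /eq_row_mx[/eqP xd0 /eqP xy0].
  have /kerp [w wE] : x *m dp i = 0 by apply/eqP; rewrite -oppr_eq0 -mulmxN.
  have xphi : x *m phi i.+1 = - y *m dq i.+1 by apply/eqP; rewrite mulNmx -addr_eq0.
  have /kerq [z zE] : (y + w *m phi i.+2) *m dq i.+1 = 0.
    by rewrite mulmxDl -mulmxA -phiS mulmxA -wE xphi mulNmx subrr.
  exists (row_mx (- w) z); rewrite mul_row_block mulmx0 addr0 mulNmx mulmxN opprK -wE.
  by rewrite mulNmx -zE addrC addrK.
Qed.

(* Modulo the maximal ideal only the comparison map [phi] survives in the differential. *)
Lemma cone_diff_factorl (k : comNzRingType) (pi : {rmorphism R -> k}) i :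
  (forall i, map_mx pi (dp i) = 0) -> (forall i, map_mx pi (dq i) = 0) ->
  exists (X : 'M_(_, p i)) Y, map_mx pi (cone_diff i) = X *m Y.
Proof.
move=> dp0 dq0; exists (col_mx 1%:M 0); case: i => [|i] /=.
  by exists (map_mx pi (phi 0%N)); rewrite map_col_mx dq0 mul_col_mx mul1mx mul0mx.
exists (row_mx 0 (map_mx pi (phi i.+1))).
by rewrite map_block_mx map_mxN dp0 dq0 oppr0 map_mx0 mul_col_row !mul1mx !mul0mx.
Qed.

Lemma cone_diff_factorr (k : comNzRingType) (pi : {rmorphism R -> k}) i :
  (forall i, map_mx pi (dp i) = 0) -> (forall i, map_mx pi (dq i) = 0) ->
  exists (X : 'M_(_, q i)) Y, map_mx pi (cone_diff i) = X *m Y.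
Proof.
move=> dp0 dq0; exists (col_mx (map_mx pi (phi i)) 0); case: i => [|i] /=.
  by exists 1%:M; rewrite map_col_mx dq0 mulmx1.
exists (row_mx 0 1%:M).
by rewrite map_block_mx map_mxN dp0 dq0 oppr0 map_mx0 mul_col_row !mulmx1 !mulmx0.
Qed.

End ConeDiff.

(** The minimal resolution of [C] is a retract of the cone up to homotopy and vanishing terms,
    giving the first bound. Conversely the cone differential has rank at most [p i] and at most
    [q i] over [k]; cancelling the common summand gives the other two. *)
Lemma minres_ses_leq (A B C : lmodType R) (f : {linear A -> B}) (g : {linear B -> C}) p q s :
  is_local_ring R ->
  injective f -> (forall y, exists x, g x = y) -> (forall x, g x = 0 <-> exists y, f y = x) ->
  has_minres A p -> has_minres B q -> has_minres C s ->
  forall i, [/\ (s i.+1 <= q i.+1 + p i)%N, (p i <= s i.+1 + q i)%N & (q i <= s i + p i)%N].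
Proof.
move=> [m [max_m _]] inj_f surj_g exact_fg.
move=> [dp [epsp minp]] [dq [epsq minq]] [ds [epss mins]].
have [k [pi pi0]] := residue_ring max_m.1 max_m.2.1.
have min0 M b d eps (H : @minres R M b d eps) i : map_mx pi (d i) = 0.
  by apply/matrixP => x y; rewrite !mxE pi0 //; exact: H.2.2.2.
have resp := minres_free_res minp; have resq := minres_free_res minq.
have ress := minres_free_res mins.
have [phi [phi0 phiS]] := chain_lift (free_res_complex resp) resq f.
have res := cone_free_res inj_f surj_g exact_fg resp resq phi0 phiS.
have facts i : exists (X : 'M_(s i.+1, 0)) (Y : 'M_(0, s i)), map_mx pi (ds i) = X *m Y.
  by exists 0, 0; rewrite mul0mx (min0 _ _ _ _ mins).
have [_ leS] := free_res_size (r := fun=> 0%N) ress res facts.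
have [leP0 leP] := free_res_size res ress
  (fun i => cone_diff_factorl phi i (min0 _ _ _ _ minp) (min0 _ _ _ _ minq)).
have [leQ0 leQ] := free_res_size res ress
  (fun i => cone_diff_factorr phi i (min0 _ _ _ _ minp) (min0 _ _ _ _ minq)).
move=> i; split; first by move: (leS i); rewrite !addn0 /= addnC.
  by move: (leQ i); rewrite /= leq_add2r.
case: i => [//|i].
by move: (leP i); rewrite /= -addnA addnCA leq_add2l.
Qed.

(* [X *m d] on matrices with [a] rows is the [a]-fold sum of the complex [d]; [mxvec] flattens it. *)
Lemma has_minres_ffun (M : lmodType R) b a :
  has_minres M b -> has_minres {ffun 'I_a -> M} (fun i => (a * b i)%N).
Proof.
move=> [d [eps [surj [ker0 [ker min]]]]].
pose e (v : 'rV[R]_(a * b 0)) : {ffun 'I_a -> M} := [ffun j => eps (row j (vec_mx v))].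
have lin_e : linear e.
  by move=> c u v; apply/ffunP => j; rewrite !ffunE !linearP.
pose e' : {linear 'rV[R]_(a * b 0) -> {ffun 'I_a -> M}} :=
  HB.pack e (GRing.isLinear.Build _ _ _ _ e lin_e).
have img i (v : 'rV[R]_(a * b i)) :
    (forall j, exists w, row j (vec_mx v) = w *m d i) <-> exists w, v = w *m lin_mx (mulmxr (d i)).
  split=> [/rows_factor[Y YE]|[w ->] j].
    by exists (mxvec Y); rewrite mul_vec_lin /= -YE vec_mxK.
  by exists (row j (vec_mx w)); rewrite -row_mul -[w in LHS]vec_mxK mul_vec_lin mxvecK.
exists (fun i => lin_mx (mulmxr (d i))), e'; split=> [x|]; last split=> [v|]; last split=> [i v|].
- have [v vE] := boolp.choice (fun j => surj (x j)).
  by exists (mxvec (\matrix_j v j)); apply/ffunP => j; rewrite ffunE mxvecK rowK.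
- rewrite -img; split=> [ev0 j|evj].
    by apply/ker0; have /ffunP/(_ j) := ev0; rewrite !ffunE.
  by apply/ffunP => j; rewrite !ffunE; apply/ker0.
- rewrite -img mul_rV_lin /=; split=> [/eqP vd0 j|vd0].
    by apply/ker; move: vd0; rewrite mxvec_eq0 => /eqP vd0; rewrite -row_mul vd0 row0.
  apply/eqP; rewrite mxvec_eq0; apply/eqP/row_matrixP => j; rewrite row_mul row0.
  by apply/ker.
move=> m max_m i x y; rewrite !mxE /=.
have [[m0 [mD mM]] _] := max_m.
case/mxvec_indexP: y => y1 y2; rewrite mxvecE mxE.
(* The entry is a sum of multiples of entries of [d i], so it stays in the ideal. *)
by elim/big_ind: _ => // j _; apply: mM; apply: min.
Qed.

(** For positive [n] the tail of the resolution resolves the syzygy, augmented by the corestriction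
    of a differential along [iota]; for [n = 0] the augmentation is transported along the
    isomorphism. *)
Lemma has_minres_syzygy (M N : lmodType R) n b :
  is_local_ring R -> has_minres M b -> is_syzygy n M N ->
  exists b', has_minres N b' /\ forall i, b' i = betti M (i + n).
Proof.
move=> locR minM; case: n => [[h [h' hK h'K]]|n [c [d [eps [minc [iota [inj_iota img]]]]]]].
  have [d [eps [surj [ker0 ker]]]] := minM.
  exists b; split=> [|i]; last by rewrite addn0 (betti_minres _ locR minM).
  have [e eE] := @free_lift _ _ _ _ eps h (fun v => ex_intro _ (h' (eps v)) (h'K _)).
  have e0 v : e v = 0 <-> eps v = 0.
    by rewrite -eE; split=> [->|]; [exact: linear0|rewrite -(linear0 h); exact: (can_inj hK)].
  exists d, e; split; last by split=> // v; rewrite e0.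
  by move=> x; have [v vE] := surj (h x); exists v; apply: (can_inj hK); rewrite eE.
(* With the shift added on the right, [i.+1 + n.+1] reduces to a successor and the shifted
   differentials are well typed. *)
exists (fun i => c (i + n.+1)%N); split=> [|i]; last first.
  by symmetry; apply: (betti_minres (b := c)) => //; exists d, eps.
have [_ [_ [ker min]]] := minc.
have proj (v : 'rV[R]_(c n.+1)) : exists x, iota x = mulmxr (d n) v by apply/img; exists v.
have [e eE] := free_lift proj.
exists (fun i => d (i + n.+1)%N), e; split=> [x|].
  have /img[v vE] : exists y, iota y = iota x by exists x.
  by exists v; apply: inj_iota; rewrite eE.
split=> [v|]; last by split=> [i v|m max_m i]; [exact: ker|exact: min].
rewrite -ker -[v *m d n]/(mulmxr (d n) v) -eE.
by split=> [->|]; [exact: linear0|rewrite -(linear0 iota); exact: inj_iota].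
Qed.

End Cone.

(** * Existence of minimal free resolutions over a Noetherian local ring *)

Section Existence.
Variable R : comUnitRingType.

Definition submod (n : nat) (S : 'rV[R]_n -> Prop) : Prop :=
  S 0 /\ (forall u v, S u -> S v -> S (u + v)) /\ (forall c u, S u -> S (c *: u)).

Lemma submod_mulmx n (S : 'rV[R]_n -> Prop) k (w : 'rV_k) (D : 'M_(k, n)) :
  submod S -> (forall i, S (row i D)) -> S (w *m D).
Proof.
move=> [S0 [SD SZ]] SDrow; rewrite mulmx_sum_row.
by elim/big_ind: _ => // i _; apply: SZ.
Qed.

(** Induction on the rank: the leading coordinates form a finitely generated ideal, and the vectors
    of [S] with leading coordinate 0 form a submodule of smaller rank. Lifts of the former
    generators ([G]) and the latter generators ([E]) together generate [S]. *)
Lemma noetherian_submod n (S : 'rV[R]_n -> Prop) :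
  is_noetherian_ring R -> submod S ->
  exists k (D : 'M_(k, n)), forall v, S v <-> exists w, v = w *m D.
Proof.
move=> noethR; elim: n S => [|n IH] S subS.
  exists 0%N, 0 => v; split=> [_|_]; first by exists 0; rewrite !thinmx0.
  by rewrite thinmx0; exact: subS.1.
have [S0 [SD SZ]] := subS.
pose I x := exists v : 'rV_n, S (row_mx x%:M v : 'rV_(1 + n)).
have idI : is_ideal I.
  split; first by exists 0; rewrite rmorph0 row_mx0.
  split=> [x y [u Su] [v Sv]|r x [u Su]].
    by exists (u + v); rewrite rmorphD -add_row_mx; apply: SD.
  by exists (r *: u); rewrite -scale_scalar_mx -scale_row_mx; apply: SZ.
have [s sI] := noethR I idI.
have Is (i : 'I_(size s)) : I s`_i.
  apply/sI; exists (fun j => (j == i)%:R); rewrite (bigD1 i) //= eqxx mul1r big1 ?addr0 //.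
  by move=> j /negPf ->; rewrite mul0r.
have [v vS] := boolp.choice Is.
pose S' u := S (row_mx (0 : 'rV_1) u : 'rV_(1 + n)).
have subS' : submod S'.
  split; first by rewrite /S' row_mx0.
  split=> [x y Sx Sy|c x Sx]; rewrite /S'.
    by rewrite -[X in row_mx X _](addr0 0) -add_row_mx; apply: SD.
  by rewrite -[X in row_mx X _](scaler0 _ c) -scale_row_mx; apply: SZ.
have [k [D DE]] := IH S' subS'.
pose G : 'M_(size s, 1 + n) := \matrix_i row_mx (s`_i)%:M (v i).
pose E : 'M_(k, 1 + n) := row_mx 0 D.
have mulE (z : 'rV_k) : z *m E = row_mx 0 (z *m D) by rewrite mul_mx_row mulmx0.
have SG w : S (w *m G) by apply: submod_mulmx => // i; rewrite rowK.
exists (size s + k)%N, (col_mx G E) => x; split=> [Sx|[w ->]]; last first.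
  rewrite -[w]hsubmxK mul_row_col; apply: (SD _ _ (SG _)).
  by rewrite mulE; apply/DE; exists (rsubmx w).
have /sI[c cE] : I (lsubmx (x : 'rV_(1 + n)) 0 0).
  by exists (rsubmx (x : 'rV_(1 + n))); rewrite -mx11_scalar hsubmxK.
pose w := \row_i c i.
have wG : (w *m G) 0 (lshift n 0) = \sum_i c i * s`_i.
  rewrite mxE; apply: eq_bigr => i _; rewrite [w 0 i]mxE [G _ _]mxE; congr (_ * _).
  by rewrite -[LHS]/(row_mx (s`_i)%:M (v i) 0 (lshift n 0)) row_mxEl mxE mulr1n.
have lx : lsubmx (x - w *m G : 'rV_(1 + n)) = 0.
  apply/rowP => j; rewrite ord1 [LHS]mxE [LHS]mxE [X in _ + X]mxE wG -cE.
  by rewrite mxE subrr mxE.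
have /DE[z zE] : S' (rsubmx (x - w *m G : 'rV_(1 + n))).
  rewrite /S' -[X in row_mx X _]lx hsubmxK; apply: SD => //.
  by rewrite -scaleN1r; apply: SZ.
exists (row_mx w z); rewrite mul_row_col mulE -zE -[X in row_mx X _]lx hsubmxK.
by rewrite addrC subrK.
Qed.

(* A shortest generating family: a relation with a unit coefficient would allow dropping a
   generator. *)
Lemma minimal_cover (L : lmodType R) (T : L -> Prop) (m : R -> Prop) n (h : {linear 'rV[R]_n -> L}) :
  (forall x, ~ m x -> x \is a GRing.unit) ->
  (forall x, T x <-> exists v, h v = x) ->
  exists k (e : {linear 'rV[R]_k -> L}), (forall x, T x <-> exists v, e v = x) /\
    forall v, e v = 0 -> forall j, m (v 0 j).
Proof.
move=> mU hT.
pose gen k := boolp.asbool (exists e : {linear 'rV[R]_k -> L}, forall x, T x <-> exists v, e v = x).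
have ex_gen : exists k, gen k by exists n; apply/boolp.asboolP; exists h.
case: (ex_minnP ex_gen) => k /boolp.asboolP[e eT] min_k.
exists k, e; split=> // v ev0 j; apply: boolp.contrapT => /mU Uv.
case: k e eT min_k v ev0 j Uv => [|k] e eT min_k v ev0 j Uv; first by case: j Uv.
suff /min_k : gen k by rewrite ltnn.
apply/boolp.asboolP; exists (e \o mulmxr (row' j 1%:M)) => x; split=> [/eT[u uE]|[w <-]]; last first.
  by apply/eT; exists (w *m row' j 1%:M).
(* As [v 0 j] is a unit, subtracting a multiple of the relation [v] clears coordinate [j] without
   changing the image; [row' j 1%:M] reinserts that zero coordinate. *)
pose w := u - (u 0 j / v 0 j) *: v.
exists (col' j w) => /=.
suff -> : col' j w *m row' j 1%:M = w by rewrite /w linearB linearZ /= ev0 scaler0 subr0.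
rewrite -[RHS]mulmx1 !mulmx_sum_row (bigD1_ord j) //=.
have -> : w 0 j = 0 by rewrite !mxE divrK // subrr.
rewrite scale0r add0r; apply: eq_bigr => i _; rewrite mxE; congr (_ *: _).
by apply/rowP => l; rewrite !mxE.
Qed.

(** Successive kernels are finitely generated and are covered minimally. Each kernel of a minimal
    cover has coordinates in [m], and the rows of the next differential lie in that kernel. *)
Lemma ex_minres (M : lmodType R) :
  is_noetherian_ring R -> is_local_ring R -> fin_gen M -> exists b, has_minres M b.
Proof.
move=> noethR locR [n [h hsurj]]; have [m [max_m uniq_m]] := locR.
have mU x : ~ m x -> x \is a GRing.unit by exact: local_unit.
have hT x : True <-> exists v, h v = x by [].
have [b0 [eps [epsT eps_min]]] := minimal_cover mU hT.
(* A state is a rank together with the submodule of that free module still to be covered. *)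
pose St := {k & {S : 'rV[R]_k -> Prop | submod S}}.
have next (st : St) : exists k (D : 'M_(k, projT1 st)),
    (forall v, sval (projT2 st) v <-> exists w, v = w *m D) /\
    forall w : 'rV_k, w *m D = 0 -> forall j, m (w 0 j).
  case: st => l [S subS] /=; have [k0 [D0 D0E]] := noetherian_submod noethR subS.
  have D0E' x : S x <-> exists v, mulmxr D0 v = x.
    by rewrite D0E; split=> -[v vE]; exists v; exact: esym vE.
  have [k [e [eT emin]]] := minimal_cover mU D0E'.
  exists k, (lin1_mx e); split=> [v|w] /=; last by rewrite (mul_rV_lin1 e); exact: emin.
  by rewrite eT; split=> -[w wE]; exists w; move: wE; rewrite (mul_rV_lin1 e).
pose K st := sval (boolp.cid (next st)).
pose D st : 'M_(K st, projT1 st) := sval (boolp.cid (svalP (boolp.cid (next st)))).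
have DP st : (forall v, sval (projT2 st) v <-> exists w, v = w *m D st) /\
    forall w : 'rV_(K st), w *m D st = 0 -> forall j, m (w 0 j).
  exact: (svalP (boolp.cid (svalP (boolp.cid (next st))))).
have sub_ker k (L : lmodType R) (e : {linear 'rV[R]_k -> L}) : submod (fun w => e w = 0).
  split; first exact: linear0.
  by split=> [u v eu0 ev0|c u eu0]; rewrite ?linearD ?linearZ /= eu0 ?ev0 ?addr0 ?scaler0.
pose ker_st (st : St) : St :=
  existT _ (K st) (exist _ (fun w => w *m D st = 0) (sub_ker _ _ (mulmxr (D st)))).
pose st0 : St := existT _ b0 (exist _ (fun w => eps w = 0) (sub_ker _ _ eps)).
pose st i := iter i ker_st st0.
have mst i v : sval (projT2 (st i)) v -> forall j, m (v 0 j).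
  by case: i v => [|i] v; [exact: eps_min|exact: (DP (st i)).2].
exists (fun i => projT1 (st i)), (fun i => D (st i)), eps.
split=> [x|]; first by apply/epsT.
split=> [v|]; first exact: (DP st0).1.
split=> [i v|m' max_m' i j k]; first exact: (DP (st i.+1)).1.
apply/(uniq_m _ max_m'); have := mst i (row j (D (st i))) _ k; rewrite mxE; apply.
by apply/(DP (st i)).1; exists (delta_mx 0 j); rewrite rowE.
Qed.

(* Long exact sequence of Tor, in the form of inequalities between Betti numbers. *)
Lemma betti_ses (M K N : lmodType R) a b n
    (f : {linear {ffun 'I_a -> M} -> K}) (g : {linear K -> {ffun 'I_b -> N}}) :
  is_noetherian_ring R -> is_local_ring R -> fin_gen M -> fin_gen K -> is_syzygy n M N ->
  injective f -> (forall y, exists x, g x = y) -> (forall x, g x = 0 <-> exists y, f y = x) ->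
  forall i, [/\ (b * betti M (i.+1 + n) <= betti K i.+1 + a * betti M i)%N,
    (a * betti M i <= b * betti M (i.+1 + n) + betti K i)%N &
    (betti K i <= b * betti M (i + n) + a * betti M i)%N].
Proof.
move=> noethR locR fgM fgK syzN inj_f surj_g exact_fg i.
have [p minM] := ex_minres noethR locR fgM.
have [q minK] := ex_minres noethR locR fgK.
have [s [minN sE]] := has_minres_syzygy locR minM syzN.
rewrite -!sE !(betti_minres _ locR minM) !(betti_minres _ locR minK).
exact: (minres_ses_leq locR inj_f surj_g exact_fg (has_minres_ffun _ minM) minK
  (has_minres_ffun _ minN)).
Qed.

End Existence.

(** * Polynomial growth under linear recursive inequalities *)

Section Growth.
Local Open Scope nat_scope.
Implicit Types beta kappa : nat -> nat.

(* The comparison function [i ^ (c - 1)]; at [c = 0] the bound [A / i] on natural numbers means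
   vanishing for large [i]. *)
Definition poly_scale (c i : nat) : nat := if c is r.+1 then i ^ r else 0.

Definition poly_growth beta c : Prop :=
  exists A N, forall i, N <= i -> beta i <= A * poly_scale c i.

Lemma INR_expn i r : INR (i ^ r) = (INR i ^ r)%coqR.
Proof. by elim: r => // r IH; rewrite expnS mult_INR IH. Qed.

Lemma cx_bound_poly_growth beta c : cx_bound beta c <-> poly_growth beta c.
Proof.
have powS i r : powerRZ (INR i) (Z.of_nat r.+1 - 1)%coqZ = INR (i ^ r).
  have -> : (Z.of_nat r.+1 - 1 = Z.of_nat r)%coqZ by lia.
  by rewrite -pow_powerRZ INR_expn.
split=> -[A [N bnd]]; last first.
  exists (INR A), N.+1 => i lt_Ni.
  have := le_INR _ _ (elimT leP (bnd i (ltnW lt_Ni))).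
  case: c bnd => [|r] _ /=; rewrite mult_INR; last by rewrite powS.
  rewrite Rmult_0_r => h; apply: Rle_trans h _; apply: Rmult_le_pos (pos_INR _) _.
  rewrite Rmult_1_r; apply: Rlt_le; apply: Rinv_0_lt_compat; apply: lt_0_INR; lia.
pose B := Z.to_nat (up A).
have leAB : (A <= INR B)%coqR.
  have [upA _] := archimed A; rewrite INR_IZR_INZ.
  apply: Rle_trans (Rlt_le _ _ upA) _; apply: IZR_le; rewrite /B; lia.
(* Beyond this threshold [i > B >= A], so at [c = 0] the bound [A / i] is below 1 and the natural
   number [beta i] is 0. *)
exists B, (N + B).+1 => i le_i; have := bnd i ltac:(lia); case: c {bnd} => [|r].
  rewrite /= muln0 Rmult_1_r => le_inv; apply/leP/Nat.lt_succ_r/INR_lt.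
  have i_gt0 : (0 < INR i)%coqR by apply: lt_0_INR; lia.
  have ltBi : (INR B < INR i)%coqR by apply: lt_INR; lia.
  apply: Rle_lt_trans le_inv _; rewrite -[X in (_ < X)%coqR](Rinv_r (INR i)); last by lra.
  by apply: Rmult_lt_compat_r; [exact: Rinv_0_lt_compat|lra].
rewrite powS => le_beta; apply/leP/INR_le; rewrite mult_INR.
by apply: Rle_trans le_beta _; apply: Rmult_le_compat_r => //; exact: pos_INR.
Qed.

Lemma poly_scale_leq c i j : i <= j -> poly_scale c i <= poly_scale c j.
Proof. by case: c => // r le_ij; case: r => [|r]; rewrite //= leq_exp2r. Qed.

(** Discrete integration: an increment of one scale dominates the scale one degree lower. *)
Lemma poly_scaleS c j : poly_scale c.+1 j + poly_scale c j.+1 <= poly_scale c.+1 j.+1.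
Proof.
case: c => [|r] //=.
rewrite !expnS mulSn addnC leq_add2l; apply: leq_mul => //.
exact: (@poly_scale_leq r.+1).
Qed.

(** Bernoulli's inequality for [(1 - s / (i + s)) ^ r], cleared of denominators; truncated
    subtraction handles the negative case. *)
Lemma expn_bernoulli r s i : (i + s) ^ r * (i + s - r * s) <= i ^ r * (i + s).
Proof.
elim: r => [|r IH]; first by rewrite mul0n subn0.
rewrite !expnS; have [|le] := leqP (i + s) (r.+1 * s).
  by rewrite -subn_eq0 => /eqP ->; rewrite muln0.
have key : (i + s) * (i + s - r.+1 * s) <= i * (i + s - r * s) by nia.
by nia.
Qed.

Lemma poly_scale_shift c s q :
  exists N, forall i, N <= i -> q * poly_scale c (i + s) <= q.+1 * poly_scale c i.
Proof.
case: c => [|r]; first by exists 0 => i _; rewrite !muln0.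
(* Past this threshold the Bernoulli factor [1 - r * s / (i + s)] is at least [q / q.+1]. *)
exists (q.+1 * r * s).+1 => i le_i /=; have bern := expn_bernoulli r s i.
rewrite -(leq_pmul2r (m := i + s)); last by lia.
have : q * (i + s) <= q.+1 * (i + s - r * s) by nia.
move: (i + s) (i + s - r * s) bern => x y bern le_xy.
have : (x ^ r) * (q * x) <= (x ^ r) * (q.+1 * y) by rewrite leq_mul2l le_xy orbT.
by nia.
Qed.

Lemma bounded_below beta N : exists B, forall j, j < N -> beta j <= B.
Proof.
exists (\sum_(j < N) beta j) => j lt_jN.
by rewrite (bigD1 (Ordinal lt_jN)) //= leq_addr.
Qed.


Lemma poly_growth_add beta kappa a b n c :
  (forall i, kappa i <= b * beta (i + n) + a * beta i) ->
  poly_growth beta c -> poly_growth kappa c.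
Proof.
(* Taking [q = 1] bounds the shifted scale by twice the original one. *)
move=> le_kappa [A [N bnd]]; have [N' shift] := poly_scale_shift c n 1.
exists (b * (A * 2) + a * A), (N + N') => i le_i.
apply: leq_trans (le_kappa i) _; rewrite mulnDl -!mulnA; apply: leq_add.
  rewrite leq_mul2l; apply/orP; right; apply: leq_trans (bnd (i + n) _) _; first by lia.
  by rewrite leq_mul2l -[X in X <= _]mul1n shift ?orbT //; lia.
by rewrite leq_mul2l bnd ?orbT //; lia.
Qed.

(** Comparison principle: a supersolution [phi] that dominates on an initial window of length [s]
    dominates everywhere after it. *)
Lemma recursion_leq beta kappa (phi : nat -> nat) a b s N :
  0 < b -> 0 < s -> (forall i, b * beta (i + s) <= kappa i.+1 + a * beta i) ->
  (forall i, N <= i -> kappa i.+1 + a * phi i <= b * phi (i + s)) ->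
  (forall j, N <= j < N + s -> beta j <= phi j) ->
  forall j, N <= j -> beta j <= phi j.
Proof.
move=> b_gt0 s_gt0 rec step init.
elim/ltn_ind => j IH le_Nj; have [lt_j|le_j] := ltnP j (N + s).
  by apply: init; rewrite le_Nj.
have jE : j = j - s + s by lia.
have := rec (j - s); have := step (j - s) ltac:(lia); rewrite -jE.
have := IH (j - s) ltac:(lia) ltac:(lia) => IHj stepj recj.
rewrite -(leq_pmul2l b_gt0); apply: leq_trans recj _; apply: leq_trans stepj.
by rewrite leq_add2l leq_mul2l IHj orbT.
Qed.

Lemma poly_growth_balanced beta kappa b s c :
  0 < b -> 0 < s -> (forall i, b * beta (i + s) <= kappa i.+1 + b * beta i) ->
  poly_growth kappa c -> poly_growth beta c.+1.
Proof.
move=> b_gt0 s_gt0 rec [A [N bnd]]; have [B initB] := bounded_below beta (N.+1 + s).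
(* [A] absorbs the forcing term [kappa] and [B] the initial window; starting at [N.+1] keeps the
   scale positive there. *)
exists (A + B), N.+1; apply: (recursion_leq b_gt0 s_gt0 rec) => [i le_i|j /andP[le_j lt_j]].
  have := bnd i.+1 ltac:(lia) => leK.
  have le_s : poly_scale c.+1 i.+1 <= poly_scale c.+1 (i + s) by apply: poly_scale_leq; lia.
  apply: leq_trans (_ : b * ((A + B) * poly_scale c.+1 i.+1) <= _); last first.
    by rewrite !leq_mul2l le_s !orbT.
  apply: leq_trans (_ : b * ((A + B) * (poly_scale c.+1 i + poly_scale c i.+1)) <= _).
    by nia.
  by rewrite !leq_mul2l poly_scaleS !orbT.
apply: leq_trans (initB j lt_j) _; apply: leq_trans (leq_addl A B) _.
by rewrite leq_pmulr //= expn_gt0; lia.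
Qed.

Lemma poly_growth_contract beta kappa a b s c :
  a < b -> 0 < s -> (forall i, b * beta (i + s) <= kappa i.+1 + a * beta i) ->
  poly_growth kappa c -> poly_growth beta c.
Proof.
move=> lt_ab s_gt0 rec growth; have b_gt0 : 0 < b by lia.
case: c growth => [|r] growth; last first.
  have [A [N bnd]] := growth; have [B initB] := bounded_below beta (N.+1 + s).
  exists (A + B), N.+1; apply: (recursion_leq b_gt0 s_gt0 rec) => [i le_i|j /andP[le_j lt_j]].
    have := bnd i.+1 ltac:(lia) => leK.
    have := @poly_scale_leq r.+1 i.+1 (i + s) ltac:(lia).
    have := @poly_scale_leq r.+1 i (i + s) ltac:(lia).
    move: (poly_scale _ (i + s)) (poly_scale _ i) (poly_scale _ i.+1) leK => x y z leK le_yx le_zx.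
    have : A * z <= A * x by rewrite leq_mul2l le_zx orbT.
    have : a * ((A + B) * y) <= a * ((A + B) * x) by rewrite !leq_mul2l le_yx !orbT.
    by nia.
  apply: leq_trans (initB j lt_j) _; apply: leq_trans (leq_addl A B) _.
  by rewrite leq_pmulr //= expn_gt0; lia.
(* At [c = 0] the term [kappa] eventually vanishes. The balanced case first makes [beta] bounded;
   then, as [a < b], each shift by [s] lowers the bound by at least 1 until it reaches 0. *)
have rec' i : b * beta (i + s) <= kappa i.+1 + b * beta i.
  by apply: leq_trans (rec i) _; rewrite leq_add2l leq_mul2r ltnW ?orbT.
have [B [N bndB]] := poly_growth_balanced b_gt0 s_gt0 rec' growth.
have [A [N' bnd]] := growth.
have desc m : forall i, N + N' + m * s <= i -> beta i <= B - m.
  elim: m => [|m IH] i le_i; first by have := bndB i ltac:(lia); rewrite /= muln1 subn0.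
  have iE : i = i - s + s by lia.
  have := rec (i - s); rewrite -iE; have := bnd (i - s).+1 ltac:(lia).
  rewrite /= muln0 leqn0 => /eqP -> ; rewrite add0n => reci.
  have := IH (i - s) ltac:(lia); by nia.
by exists 0, (N + N' + B * s) => i le_i; have := desc B i le_i; rewrite subnn.
Qed.

(* Over a shift by [s], [poly_scale] eventually grows by a factor at most [1 + 1 / (2 b)], so each
   iteration of the recursion multiplies the a priori bound of degree [r] by
   [t / (t + 1) = (2 b + 1) / (2 b + 2) < 1]. *)
Lemma poly_growth_expand beta kappa a b s c r :
  b < a -> (forall i, a * beta i <= b * beta (i + s) + kappa i) ->
  poly_growth kappa c -> poly_growth beta r -> poly_growth beta c.
Proof.
move=> lt_ba rec [A [N bnd]] [E [N' bndE]].
have [N1 shift1] := poly_scale_shift c s (2 * b).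
have [N2 shift2] := poly_scale_shift r s (2 * b).
pose M := N + N' + N1 + N2; pose t := (2 * b).+1.
(* The constant [2 * A] is reproduced by the recursion: [(2b+1) * 2A + 2A = (2b+2) * 2A], the extra
   [2A] coming from [kappa]. *)
have iter_rec m : forall i, M <= i ->
    t.+1 ^ m * beta i <= t.+1 ^ m * (2 * A * poly_scale c i) + t ^ m * (E * poly_scale r i).
  elim: m => [|m IH] i le_i.
    by rewrite !expn0 !mul1n; have := bndE i ltac:(lia); lia.
  have := IH (i + s) ltac:(lia); have := bnd i ltac:(lia); have := rec i.
  have := shift1 i ltac:(lia); have := shift2 i ltac:(lia); rewrite !expnS /t.
  move: (poly_scale c i) (poly_scale c (i + s)) (poly_scale r i) (poly_scale r (i + s)).
  move: ((2 * b).+2 ^ m) ((2 * b).+1 ^ m) (beta i) (beta (i + s)) (kappa i).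
  move=> u v be be' ka p p' q q' q_sh p_sh recb kaA IHb.
  have h1 : 2 * b * (u * be') <= 2 * b * (u * (2 * A * p') + v * (E * q')).
    by rewrite leq_mul2l IHb orbT.
  have h2 : u * (2 * A) * (2 * b * p') <= u * (2 * A) * ((2 * b).+1 * p).
    by rewrite leq_mul2l p_sh orbT.
  have h3 : v * E * (2 * b * q') <= v * E * ((2 * b).+1 * q) by rewrite leq_mul2l q_sh orbT.
  have h4 : 2 * u * (b.+1 * be) <= 2 * u * (b * be' + A * p).
    by rewrite leq_mul2l; apply/orP; right; nia.
  by nia.
exists (2 * A), M => i le_i; rewrite leqNgt; apply/negP => lt_beta.
have bern m : t ^ m * (t + m) <= t.+1 ^ m * t.
  elim: m => [|m IH]; first by rewrite addn0.
  by rewrite !expnS; move: (t ^ m) (t.+1 ^ m) IH => u v; nia.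
(* With [x = E * poly_scale r i] and [m = t * x], Bernoulli gives [t.+1 ^ m >= t ^ m * x.+1], while
   an excess of at least 1 in [beta i] would force [t.+1 ^ m <= t ^ m * x]. *)
have := iter_rec (t * (E * poly_scale r i)) i le_i; have := bern (t * (E * poly_scale r i)).
have : 0 < t ^ (t * (E * poly_scale r i)) by rewrite expn_gt0.
move: (t ^ _) (t.+1 ^ _) lt_beta => u v.
move: (E * _) (2 * A * _) (beta i) => x y be lt_beta u_gt0 uv vbe.
have h1 : v * y.+1 <= v * be by rewrite leq_mul2l lt_beta orbT.
have h2 : v <= u * x by nia.
have h3 : u * x.+1 <= v by rewrite -(@leq_pmul2r t) //; nia.
by nia.
Qed.

End Growth.

(** * Complexity and the three cases *)

Lemma cx_bound_min beta c : cx_bound beta c ->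
  exists c', [/\ cx_bound beta c', forall r, cx_bound beta r -> (c' <= r)%N & (c' <= c)%N].
Proof.
move=> bnd; have ex : exists r, boolp.asbool (cx_bound beta r) by exists c; apply/boolp.asboolP.
case: (ex_minnP ex) => c' /boolp.asboolP bnd' min_c'.
by exists c'; split=> // [r bndr|]; apply/min_c'/boolp.asboolP.
Qed.

Theorem theorem4p2 (Rg : comUnitRingType) (M K N : lmodType Rg) (a b n c : nat)
  (HRn : is_noetherian_ring Rg) (HRl : is_local_ring Rg)
  (Ha : (1 <= a)%N) (Hb : (1 <= b)%N)
  (HM : fin_gen M) (HK : fin_gen K) (HN : is_syzygy n M N)
  (f : {linear {ffun 'I_a -> M} -> K}) (g : {linear K -> {ffun 'I_b -> N}})
  (Hf : injective f) (Hg : forall y, exists x, g x = y)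
  (Hex : forall x, g x = 0 <-> exists y, f y = x)
  (HcxK : cx_is K (Some c)) :
  ((a < b)%N -> cx_is M (Some c)) /\
  (a = b -> exists c', cx_is M (Some c') /\ (c' <= c.+1)%N) /\
  ((b < a)%N -> cx_is M (Some c) \/ cx_is M None).
Proof.
have ineq := betti_ses HRn HRl HM HK HN Hf Hg Hex.
(* The shift [n.+1] is positive even for [n = 0], so the recursion always advances. *)
have rec1 i : (b * betti M (i + n.+1) <= betti K i.+1 + a * betti M i)%N.
  by rewrite addnS; case: (ineq i).
have rec2 i : (a * betti M i <= b * betti M (i + n.+1) + betti K i)%N.
  by rewrite addnS; case: (ineq i).
have [/cx_bound_poly_growth growthK minK] := HcxK.
(* This is [cx K <= cx M], the minimality half of cases (i) and (iii). *)
have lower r : cx_bound (betti M) r -> (c <= r)%N.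
  move=> /cx_bound_poly_growth growthM; apply/minK/cx_bound_poly_growth.
  by apply: (poly_growth_add (n := n) (a := a) (b := b) _ growthM) => i; case: (ineq i).
split; last split.
- move=> lt_ab; split=> //; apply/cx_bound_poly_growth.
  exact: poly_growth_contract lt_ab _ rec1 growthK.
- move=> eq_ab; rewrite eq_ab in rec1.
  have /cx_bound_poly_growth/cx_bound_min[c' [bnd min le]] :=
    poly_growth_balanced Hb (ltn0Sn n) rec1 growthK.
  by exists c'.
- move=> lt_ba; have [[r /cx_bound_poly_growth growthM]|nbnd] :=
    boolp.EM (exists r, cx_bound (betti M) r); last by right=> r bnd; apply: nbnd; exists r.
  left; split=> //; apply/cx_bound_poly_growth.
  exact: poly_growth_expand lt_ba rec2 growthK growthM.
Qed.
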